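(* Define an equivalence relation on $\mathbb{Z}_{>0}$ by $n \sim m$ if and only if $P(n) = P(m)$. Then there are infinitely many equivalence classes under the relation $\sim$.
   Context: For a positive integer $n$, define a sequence of integers $(a_k(n))_{k \geqslant 0}$ recursively by $a_0(n) = n$ and $a_{k+1}(n) = a_k(n)^2 - 1$. Let $P(n)$ be the set of all prime numbers $p$ such that $p$ divides $a_k(n)$ for some $k \geqslant 0$ (every prime divides $0$). *)

(* Defs.v *)
From mathcomp Require Import all_boot all_order all_algebra.
From mathcomp Require Import boolp classical_sets cardinality.

Set Implicit Arguments.
Unset Strict Implicit.
Unset Printing Implicit Defensive.

Import GRing.Theory.
Local Open Scope classical_set_scope.
Local Open Scope ring_scope.

(* Integer-valued: starting from n = 1 the sequence is 1, 0, -1, 0, -1, ... *)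
Fixpoint a_seq (n k : nat) : int :=
  if k is k'.+1 then a_seq n k' ^+ 2 - 1 else n%:Z.

Definition P (n : nat) : set nat :=
  [set p | prime p /\ exists k : nat, (p%:Z %| a_seq n k)%Z].

Definition P_equiv (n m : nat) : Prop := P n = P m.

(* Z_{>0} is encoded as the m : nat with 0 < m; n is only used when positive. *)
Definition P_class (n : nat) : set nat :=
  [set m | (0 < m)%N /\ P_equiv n m].

Definition P_classes : set (set nat) :=
  [set C | exists n : nat, (0 < n)%N /\ C = P_class n].

(* Main.v *)
Require Import Defs.
From mathcomp Require Import all_boot all_order all_algebra.
From mathcomp Require Import boolp classical_sets cardinality.
From mathcomp Require Import zify ring.

(** Let [f m = m ^ 2 - m - 1] ([fixpt_poly]), the polynomial whose roots are the
    fixed points of [x |-> x ^ 2 - 1].  If a prime [p] divides [f m], then the sequence that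
    starts at [m] is constant modulo [p]; its value there is not 0, because 0 is
    not a root of [f] modulo [p].  So [p] is not in [P m] ([fixed_notin_P]).
    On the other hand [p] is in [P n] as soon as [p] divides [n] itself
    ([dvdn_in_P]).  Hence [P m] and [P n] differ whenever [f m] has a prime
    factor and divides [n] ([P_neq]).

    This yields infinitely many classes by Euclid's device: starting from 3, and
    multiplying at each step by the value of [f], gives a sequence of integers
    each of which is divisible by the value of [f] at every earlier one.  Its
    terms are pairwise inequivalent. *)

Set Implicit Arguments.
Unset Strict Implicit.
Unset Printing Implicit Defensive.

Import GRing.Theory.
Local Open Scope classical_set_scope.
Local Open Scope ring_scope.

(** Written as [m * (m - 1) - 1] so that no natural number subtraction truncates
    once [1 < m]. *)
Definition fixpt_poly (m : nat) : nat := (m * m.-1)%N.-1.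

Lemma fixpt_poly_int (m : nat) : (1 < m)%N ->
  (fixpt_poly m)%:Z = m%:Z ^+ 2 - m%:Z - 1.
Proof. by case: m => [|[|m]] // _; rewrite /fixpt_poly; nia. Qed.

Lemma fixpt_poly_gt1 (m : nat) : (2 < m)%N -> (1 < fixpt_poly m)%N.
Proof. by rewrite /fixpt_poly; nia. Qed.

Lemma dvdn_in_P (p n : nat) : prime p -> (p %| n)%N -> P n p.
Proof. by move=> p_pr p_n; split=> //; exists 0%N. Qed.

(** Modulo a divisor [d] of [f m] the starting point is fixed, since
    [(a ^ 2 - 1) - m = (a - m) * (a + m) + f m]. *)
Lemma a_seq_fixed (d m k : nat) : (1 < m)%N -> (d %| fixpt_poly m)%N ->
  (d%:Z %| a_seq m k - m%:Z)%Z.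
Proof.
move=> m_gt1 d_f; elim: k => [|k IHk] /=; first by rewrite subrr dvdz0.
set a := a_seq m k in IHk *.
have -> : a ^+ 2 - 1 - m%:Z = (a - m%:Z) * (a + m%:Z) + (fixpt_poly m)%:Z.
  by rewrite fixpt_poly_int //; ring.
by rewrite rpredD ?dvdz_mulr.
Qed.

Lemma fixed_notin_P (p m : nat) : (1 < m)%N -> (p %| fixpt_poly m)%N -> ~ P m p.
Proof.
move=> m_gt1 p_f [p_pr [k p_ak]].
have p_m : (p%:Z %| m%:Z)%Z.
  have -> : m%:Z = a_seq m k - (a_seq m k - m%:Z) by ring.
  by rewrite rpredB ?a_seq_fixed.
(* [m * (m - 1) - f m = 1], so a common divisor of [m] and [f m] is a unit *)
have : (p%:Z %| m%:Z * (m%:Z - 1) - (fixpt_poly m)%:Z)%Z.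
  by rewrite rpredB ?dvdz_mulr.
have -> : m%:Z * (m%:Z - 1) - (fixpt_poly m)%:Z = 1.
  by rewrite fixpt_poly_int //; ring.
by rewrite dvdz1 absz_nat => /eqP p1; rewrite p1 in p_pr.
Qed.

(** A prime factor of [f m] lies in [P n] but not in [P m]; the bound on [m]
    provides one, since [f 2 = 1]. *)
Lemma P_neq (m n : nat) : (2 < m)%N -> (fixpt_poly m %| n)%N -> P m <> P n.
Proof.
move=> m_gt2 f_n Pmn; have f_gt1 := fixpt_poly_gt1 m_gt2.
have p_f := pdiv_dvd (fixpt_poly m).
apply: (fixed_notin_P (ltnW m_gt2) p_f).
by rewrite Pmn; apply: dvdn_in_P (pdiv_prime f_gt1) (dvdn_trans p_f f_n).
Qed.

(** The first term is the least [m] for which [f m] has a prime factor. *)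
Fixpoint euclid_seq (i : nat) : nat :=
  if i is j.+1 then (euclid_seq j * fixpt_poly (euclid_seq j))%N else 3%N.

Lemma euclid_seq_gt2 (i : nat) : (2 < euclid_seq i)%N.
Proof. by elim: i => //= i IHi; have := fixpt_poly_gt1 IHi; nia. Qed.

Lemma fixpt_poly_dvd_euclid_seq (i j : nat) :
  (i < j)%N -> (fixpt_poly (euclid_seq i) %| euclid_seq j)%N.
Proof.
elim: j => //= j IHj; rewrite ltnS leq_eqVlt => /predU1P[->|/IHj].
  exact: dvdn_mull.
exact: dvdn_mulr.
Qed.

Lemma P_class_inj (m n : nat) : (0 < n)%N -> P_class m = P_class n -> P m = P n.
Proof. by move=> n_gt0 Cmn; have [] : P_class m n by rewrite Cmn. Qed.

Lemma P_class_euclid_seq_inj : injective (fun i => P_class (euclid_seq i)).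
Proof.
have lt_neq i j : (i < j)%N -> P_class (euclid_seq i) <> P_class (euclid_seq j).
  move=> lt_ij /P_class_inj Pij.
  apply: (P_neq (euclid_seq_gt2 i) (fixpt_poly_dvd_euclid_seq lt_ij)).
  by apply: Pij; apply: leq_trans (euclid_seq_gt2 j).
move=> i j Cij; case: (ltngtP i j) => // [/lt_neq|/lt_neq] //.
by move=> /(_ (esym Cij)).
Qed.

Theorem theorem4p2 : infinite_set P_classes.
Proof.
apply: (@sub_infinite_set _ ((fun i => P_class (euclid_seq i)) @` setT)).
  move=> _ [i _ <-]; exists (euclid_seq i).
  by split=> //; apply: leq_trans (euclid_seq_gt2 i).
have inj : {in setT &, injective (fun i => P_class (euclid_seq i))}.
  by move=> i j _ _ /P_class_euclid_seq_inj.
by rewrite (eq_finite_set (inj_card_eq inj)); apply: infinite_nat.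
Qed.
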